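(* For a positive integer $m$ let $\tau(m)$ denote the number of positive divisors of $m$, and for positive integers $n$ define $f(n):=\sum_{1\le k\le n} \tau(2^k-1)$. Call a positive integer $N$ an index of a highly-composite Mersenne number if $\tau(2^N-1)>\tau(2^m-1)$ for all integers $1\le m<N$. Assume that, as $N$ tends to infinity through the indices of highly-composite Mersenne numbers, $\tau(2^N+1)/N\to\infty$. Then $$\lim_{n\to\infty}\frac{f(2n)}{f(n)}=\infty.$$
   Context: $\tau(m)$ is the number of positive divisors of $m$. The set of indices of highly-composite Mersenne numbers (as defined in the claim) is infinite, so the limit along this set in the hypothesis makes sense. *)

(* Defs.v *)
From mathcomp Require Import all_boot.

Set Implicit Arguments.
Unset Strict Implicit.
Unset Printing Implicit Defensive.

(* Only values at m > 0 are meaningful: [divisors 0] is the empty sequence. *)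
Definition tau (m : nat) : nat := size (divisors m).

Definition f (n : nat) : nat := \sum_(1 <= k < n.+1) tau (2 ^ k - 1).

Definition hc_mersenne_index (N : nat) : Prop :=
  0 < N /\ forall m : nat, 1 <= m < N -> tau (2 ^ m - 1) < tau (2 ^ N - 1).

(* Main.v *)
(* Let N <= n be the least index maximising t := tau (2 ^ k - 1) over
   1 <= k <= n, so that f n <= n * t.  Each of the n %/ N multiples 2 * N * j
   of 2 * N up to 2 * n contributes to f (2 * n) at least
   tau (2 ^ (2 * N) - 1) = t * tau (2 ^ N + 1), the two factors 2 ^ N - 1 and
   2 ^ N + 1 being coprime.  If tau (2 ^ N + 1) >= M * N, this gives
   2 * f (2 * n) >= 2 * (n %/ N) * t * M * N >= M * n * t >= M * f n.  Finally N
   tends to infinity with n because tau (2 ^ k - 1) is unbounded. *)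
Require Import Defs.
From mathcomp Require Import all_boot all_order all_algebra.
From mathcomp Require Import all_classical all_reals all_analysis.
From mathcomp Require Import zify.
Import Order.TTheory GRing.Theory Num.Theory.
Import numFieldNormedType.Exports.
Local Open Scope classical_set_scope.
Local Open Scope ring_scope.

Section NatBounds.
Local Open Scope nat_scope.

Lemma leq_tau_dvdn a b : 0 < b -> a %| b -> tau a <= tau b.
Proof.
move=> b0 ab; apply: uniq_leq_size; first exact: divisors_uniq.
move=> d; rewrite -!dvdn_divisors ?(dvdn_gt0 b0 ab) // => da.
exact: dvdn_trans da ab.
Qed.

(** The products [d * e] with [d %| a] and [e %| b] are divisors of [a * b], and they are pairwise
    distinct because coprimality recovers [d] as [gcdn a (d * e)]. *)
Lemma leq_tauM_coprime a b : 0 < a -> 0 < b -> coprime a b ->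
  tau a * tau b <= tau (a * b).
Proof.
move=> a0 b0 cab; rewrite /tau -(size_allpairs muln).
apply: uniq_leq_size; last first.
  move=> _ /allpairsP[[d e] /= [+ + ->]].
  by rewrite -!dvdn_divisors ?muln_gt0 ?a0 //; apply: dvdn_mul.
have gcdMa d e : d %| a -> e %| b -> gcdn a (d * e) = d.
  move=> da eb; rewrite Gauss_gcdl; first exact/gcdn_idPr.
  exact: coprime_dvdr eb cab.
apply: allpairs_uniq; [exact: divisors_uniq|exact: divisors_uniq|].
move=> _ _ /allpairsP[[d e] /= [+ + ->]] /allpairsP[[d' e'] /= [+ + ->]] /=.
rewrite -!dvdn_divisors // => da eb d'a e'b deq.
have dd : d = d' by rewrite -(gcdMa d e) // deq gcdMa.
by move/eqP: deq; rewrite -dd eqn_pmul2l ?(dvdn_gt0 a0 da) // => /eqP ->.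
Qed.

Lemma mersenne_gt0 k : 0 < k -> 0 < 2 ^ k - 1.
Proof. by move=> k0; rewrite subn_gt0 -[1](expn0 2) ltn_exp2l. Qed.

Lemma tau_mersenne_double k : 0 < k ->
  tau (2 ^ k - 1) * tau (2 ^ k + 1) <= tau (2 ^ (2 * k) - 1).
Proof.
move=> k0; have m0 := mersenne_gt0 _ k0.
have -> : 2 ^ (2 * k) - 1 = (2 ^ k - 1) * (2 ^ k + 1).
  by rewrite mulnC expnM -subn_sqr exp1n -!expnM.
apply: leq_tauM_coprime => //; first by rewrite addn1.
(* The two factors differ by 2, so their gcd divides 2, and [2 ^ k - 1] is odd. *)
have -> : 2 ^ k + 1 = 2 + (2 ^ k - 1) by lia.
rewrite /coprime gcdnDr -/(coprime _ _) coprimen2 oddB; last by lia.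
by rewrite oddX eqn0Ngt k0.
Qed.

Lemma tau_gt1 m : 1 < m -> 1 < tau m.
Proof.
move=> m1; have m0 : 0 < m by lia.
apply: (@uniq_leq_size _ [:: 1; m]) => [|d]; first by rewrite /= inE neq_ltn m1.
by rewrite !inE -dvdn_divisors // => /orP[/eqP->|/eqP->].
Qed.

(** Each doubling of the exponent [k] multiplies the count by at least [tau (2 ^ k + 1) >= 2]. This
    makes the unboundedness of [tau (2 ^ k - 1)] explicit. *)
Lemma tau_mersenne_pow2 i : 2 ^ i <= tau (2 ^ (2 ^ i) - 1).
Proof.
elim: i => [//|i IH]; rewrite expnS.
have k0 : 0 < 2 ^ i by rewrite expn_gt0.
apply: leq_trans (tau_mersenne_double _ k0); rewrite mulnC.
by apply: leq_mul => //; apply: tau_gt1; have := mersenne_gt0 _ k0; lia.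
Qed.

Lemma fS n : f n.+1 = f n + tau (2 ^ n.+1 - 1).
Proof. by rewrite /f big_nat_recr. Qed.

Lemma leq_f : {homo f : m n / m <= n}.
Proof. by apply: homo_leq => // [n m p|n]; [apply: leq_trans|rewrite fS leq_addr]. Qed.

Lemma tau_leq_f k n : 0 < k <= n -> tau (2 ^ k - 1) <= f n.
Proof.
case/andP; case: k => // k _ /leq_f; apply: leq_trans.
by rewrite fS leq_addl.
Qed.

Lemma f_multiples d q : 0 < d -> q * tau (2 ^ d - 1) <= f (d * q).
Proof.
move=> d0; elim: q => [//|q IH].
case: d d0 IH => // d _ IH.
have -> : d.+1 * q.+1 = (d.+1 * q + d).+1 by lia.
rewrite fS mulSn addnC leq_add //.
  (* The terms strictly between two consecutive multiples of [d.+1] are discarded. *)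
  by apply: leq_trans IH _; apply/leq_f/leq_addr.
have -> : (d.+1 * q + d).+1 = d.+1 * q.+1 by lia.
apply: leq_tau_dvdn; first exact: mersenne_gt0.
by rewrite expnM -[X in _ %| _ - X](exp1n q.+1) subn_exp dvdn_mulr.
Qed.

(** Induction on [n], replacing the current maximiser only when the new value is strictly larger:
    ties keep the earlier index, so the one kept beats all smaller indices strictly. *)
Lemma hc_mersenne_argmax n : 0 < n -> exists N,
  [/\ hc_mersenne_index N, N <= n &
      forall k, 0 < k <= n -> tau (2 ^ k - 1) <= tau (2 ^ N - 1)].
Proof.
elim: n => // -[_ _|n IH _].
  exists 1; split=> //; first by split=> // -[].
  by case=> // -[].
have [//|N [[N0 hN] Nn maxN]] := IH.
have [le_t|lt_t] := leqP (tau (2 ^ n.+2 - 1)) (tau (2 ^ N - 1)).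
  exists N; split=> [//||k /andP[k0]]; first exact: leqW.
  by rewrite leq_eqVlt => /orP[/eqP->//|kn]; apply: maxN; rewrite k0.
exists n.+2; split=> //.
  split=> // m mn; apply: leq_ltn_trans lt_t; exact: maxN.
move=> k /andP[k0]; rewrite leq_eqVlt => /orP[/eqP->//|kn].
by apply: leq_trans (ltnW lt_t); apply: maxN; rewrite k0.
Qed.

Lemma f_leq_max n t : (forall k, 0 < k <= n -> tau (2 ^ k - 1) <= t) ->
  f n <= n * t.
Proof.
move=> le_t; rewrite /f.
have -> : n * t = \sum_(1 <= k < n.+1) t by rewrite sum_nat_const_nat subn1.
by rewrite big_nat [leqRHS]big_nat; apply: leq_sum => k /le_t.
Qed.

Lemma f_double_lower M N n : 0 < N <= n ->
  (forall k, 0 < k <= n -> tau (2 ^ k - 1) <= tau (2 ^ N - 1)) ->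
  M * N <= tau (2 ^ N + 1) -> M * f n <= 2 * f (2 * n).
Proof.
move=> /andP[N0 Nn] maxN leM; set t := tau (2 ^ N - 1) in maxN.
have fn : f n <= n * t by exact: f_leq_max.
have q_gt0 : 0 < n %/ N by rewrite divn_gt0.
(* Since [n %/ N >= 1], the remainder is below [N <= n %/ N * N]; rounding down loses at most a
   factor 2. *)
have n_le : n <= 2 * (n %/ N * N).
  by have := divn_eq n N; have := ltn_pmod n N0; nia.
have f2n : n %/ N * (t * (M * N)) <= f (2 * n).
  apply: (@leq_trans (f (2 * N * (n %/ N)))); last first.
    by apply: leq_f; have := leq_divM n N; nia.
  apply: leq_trans (@f_multiples (2 * N) (n %/ N) _); last by rewrite muln_gt0.
  rewrite leq_mul2l; apply/orP; right.
  apply: leq_trans (tau_mersenne_double _ N0); exact: leq_mul.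
apply: (@leq_trans (M * (2 * (n %/ N * N) * t))).
  rewrite leq_mul2l; apply/orP; right; apply: leq_trans fn _.
  by rewrite leq_mul2r n_le orbT.
by apply: leq_trans (leq_mul (leqnn 2) f2n); nia.
Qed.

(** The threshold forces the maximiser [N] to be at least [N0]: otherwise
    [tau (2 ^ N - 1) <= f N0 < 2 ^ f N0], while the index [2 ^ f N0 <= n] already gives a value of
    at least [2 ^ f N0]. *)
Lemma f_double_eventually M N0 :
  (forall N, N0 <= N -> hc_mersenne_index N -> M * N <= tau (2 ^ N + 1)) ->
  forall n, 2 ^ f N0 <= n -> M * f n <= 2 * f (2 * n).
Proof.
move=> leM n le_n.
have n0 : 0 < n by apply: leq_trans le_n; rewrite expn_gt0.
have [N [hcN Nn maxN]] := hc_mersenne_argmax _ n0.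
have N_gt0 : 0 < N by case: hcN.
apply: (@f_double_lower M N) => //; first by rewrite N_gt0.
apply: leM => //; rewrite leqNgt; apply/negP => NN0.
have /maxN : 0 < 2 ^ f N0 <= n by rewrite expn_gt0.
have : tau (2 ^ N - 1) <= f N0 by apply: tau_leq_f; rewrite N_gt0 ltnW.
have := tau_mersenne_pow2 (f N0); have := ltn_expl (f N0) (ltnSn 1); lia.
Qed.

End NatBounds.

Theorem theorem2 (R : realType)
  (htau : ((tau (2 ^ N + 1)%N)%:R / N%:R : R)
            @[N --> within [set N : nat | hc_mersenne_index N] \oo] --> +oo) :
  ((f (2 * n)%N)%:R / (f n)%:R : R) @[n --> \oo] --> +oo.
Proof.
apply/cvgryPge => A.
pose M := Num.bound `|A|.
have AM : A <= M%:R.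
  by apply: le_trans (ler_norm A) _; apply/ltW/archi_boundP.
(* The bound [2 * M] compensates for the factor 2 in front of [f (2 * n)]. *)
have /cvgryPge/(_ (2 * M)%:R) := htau.
rewrite near_withinE => -[N0 _ hN0].
exists (2 ^ f N0)%N => // n /= le_n.
have leM : (2 * M * f n <= 2 * f (2 * n))%N.
  apply: (@f_double_eventually _ N0) _ le_n => N leN hcN.
  have N_gt0 : (0 < N)%N by case: hcN.
  have := hN0 N leN hcN.
  by rewrite ler_pdivlMr ?ltr0n // -natrM ler_nat.
(* The term at [k = 1] is 1, so the quotient by [f n] is a genuine one. *)
have fn_gt0 : (0 < f n)%N.
  apply: (@leq_trans (tau (2 ^ 1 - 1))) => //; apply: tau_leq_f.
  by apply: leq_trans le_n; rewrite expn_gt0.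
apply: le_trans AM _.
by rewrite ler_pdivlMr ?ltr0n // -natrM ler_nat -(leq_pmul2l (ltn0Sn 1)) mulnA.
Qed.
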